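(* For every positive integer $n$ and every integer $k\ge3$, $$N_P(n,k,k+2)\ \ge\ \Bigl(k-2+\frac{4k+16}{3k^2+k+4}\Bigr)n.$$
   Context: Fix a finite field $\mathbb{F}_q$; $[n]=\{1,\dots,n\}$. An $(n,N,k,m)$-PIR array code over $\mathbb{F}_q$ is an $\mathbb{F}_q$-linear map $\mathcal{C}:\mathbf x\in\mathbb{F}_q^n\mapsto(\mathbf c_1,\dots,\mathbf c_m)$ with buckets $\mathbf c_\ell\in\mathbb{F}_q^{N_\ell}$, $N_\ell\ge1$ independent of $\mathbf x$, $\sum_\ell N_\ell=N$, such that for every $i\in[n]$ there is a partition of $[m]$ into $k$ sets $R_1,\dots,R_k$ such that for each $j$, $x_i$ is an $\mathbb{F}_q$-linear combination of values $f_\ell(\mathbf c_\ell)$, $\ell\in R_j$, for some linear functionals $f_\ell:\mathbb{F}_q^{N_\ell}\to\mathbb{F}_q$ (independent of $\mathbf x$). $N_P(n,k,m)$ denotes the minimum $N$ for which an $(n,N,k,m)$-PIR array code over $\mathbb{F}_q$ exists. *)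

(* Defs.v *)
From mathcomp Require Import all_boot all_order all_algebra.
Set Implicit Arguments. Unset Strict Implicit. Unset Printing Implicit Defensive.
Import GRing.Theory Num.Theory.
Local Open Scope ring_scope.

(* An (n, N, k, m)-PIR array code over the finite field F.
   - bucket l (l : 'I_m) has size Nl l >= 1 and is computed from the message
     x : 'rV[F]_n by the F-linear map x |-> x *m C l  (C l : 'M_(n, Nl l));
   - N = \sum_l Nl l (see [array_code_length]);
   - for every i there is a partition of [m] into k sets, encoded as a map
     R : 'I_m -> 'I_k (part j is the set {l | R l = j}), linear functionals
     f_l : c |-> (c *m f l) 0 0 on the buckets and coefficients a l such that
     for every part j and every x, x_i = \sum_{l in R_j} a_l f_l(c_l). *)
Definition PIR_array_code (F : finFieldType) (n k m : nat)
    (Nl : 'I_m -> nat) (C : forall l : 'I_m, 'M[F]_(n, Nl l)) : Prop :=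
  (forall l, (0 < Nl l)%N) /\
  forall i : 'I_n,
    exists (R : 'I_m -> 'I_k) (f : forall l : 'I_m, 'cV[F]_(Nl l)) (a : 'I_m -> F),
      forall (j : 'I_k) (x : 'rV[F]_n),
        x 0 i = \sum_(l : 'I_m | R l == j) a l * ((x *m C l) *m f l) 0 0.

Definition array_code_length (m : nat) (Nl : 'I_m -> nat) : nat :=
  (\sum_(l < m) Nl l)%N.

(* Main.v *)
(* Let V_l be the span of the columns of bucket l. Each x_i has at most four
   buckets with e_i outside V_l; call i light if there are exactly four, in which
   case they form two pairs {a,b} with e_i in V_a + V_b. Let J_a be the set of
   light i with e_i outside V_a and w_a the rank of V_a projected to J_a, so that
   dim V_a >= #{i | e_i in V_a} + w_a. For distinct a, b, c any i in J_a has
   e_i in V_a + V_b + V_c, since two of three missing buckets are paired. If K is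
   the set of i in J_a with e_i in both V_a + V_b and V_a + V_c, and P is a set of
   w_a pivot coordinates of V_a in J_a, submodularity of rank on J_a gives
     |J_a| + |K u P| <= 2 w_a + (w_b + |J_a \ J_b|) + (w_c + |J_a \ J_c|).
   Summing over all (a, b, c) yields (2k^2+1) sum_a w_a >= 4(k+1) #light, hence
   N >= (k - 2 + 4(k+1)/(2k^2+1)) n, which is at least the claimed bound because
   (k+1)(3k^2+k+4) - (k+4)(2k^2+1) = k(k-2)^2. *)
Require Import Defs.
From mathcomp Require Import all_boot all_order all_algebra.
From mathcomp Require Import zify.
Set Implicit Arguments. Unset Strict Implicit. Unset Printing Implicit Defensive.
Import GRing.Theory Num.Theory.
Local Open Scope ring_scope.

(** * Ranks of projections to sets of coordinates *)

Section CoordinateProjections.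
Variables (F : fieldType) (n : nat).
Implicit Types (J K P : {set 'I_n}).

Local Notation evec i := (delta_mx (0 : 'I_1) i).

(** A square matrix serves two purposes: its row space is the coordinate subspace [F^J], and right
    multiplication by it projects to [J]. *)
Definition coord_proj J : 'M[F]_n := diag_mx (\row_j (j \in J)%:R).

Lemma delta_coord_proj J i :
  delta_mx 0 i *m coord_proj J = (i \in J)%:R *: delta_mx 0 i :> 'rV[F]_n.
Proof.
apply/rowP => j; rewrite /coord_proj mul_mx_diag !mxE eqxx /=.
by case: (altP (j =P i)) => [->|_]; rewrite ?mul1r ?mulr1 ?mul0r ?mulr0.
Qed.

Lemma coord_projM J K : coord_proj J *m coord_proj K = coord_proj (J :&: K).
Proof.
rewrite /coord_proj mulmx_diag; congr diag_mx.
by apply/rowP => j; rewrite !mxE in_setI -natrM mulnb.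
Qed.

Lemma coord_proj_split J K :
  coord_proj J = coord_proj (J :&: K) + coord_proj (J :\: K).
Proof.
rewrite /coord_proj -raddfD; congr diag_mx; apply/rowP => j.
by rewrite !mxE !inE; case: (j \in J); case: (j \in K); rewrite ?addr0 ?add0r.
Qed.

Lemma sub_coord_projP p (A : 'M[F]_(p, n)) J :
  reflect (forall i, i \in J -> (evec i <= A)%MS) (coord_proj J <= A)%MS.
Proof.
apply: (iffP idP) => [sJA i Ji | sJA].
  apply: submx_trans sJA; apply/submxP; exists (evec i).
  by rewrite delta_coord_proj Ji scale1r.
apply/row_subP => i; rewrite rowE delta_coord_proj.
by case: (boolP (i \in J)) => [/sJA|_]; rewrite ?scale1r ?scale0r ?sub0mx.
Qed.

Lemma coord_proj_sub_proj p (A : 'M[F]_(p, n)) J K :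
  J \subset K -> (coord_proj J <= A)%MS -> (coord_proj J <= A *m coord_proj K)%MS.
Proof.
move=> /setIidPl sJK.
by move=> sJA; rewrite -{1}sJK -coord_projM submxMr.
Qed.

(** The upper bound holds for every set. Applied to the complement of [J], whose projection and that
    of [J] add up to the identity, it also yields the lower bound. *)
Lemma rank_coord_proj J : \rank (coord_proj J) = #|J|.
Proof.
have le K : (\rank (coord_proj K) <= #|K|)%N.
  have -> : coord_proj K = \sum_(i in K) delta_mx i i.
    apply/matrixP => i j; rewrite summxE !mxE.
    case: (altP (i =P j)) => [<-|ij].
      rewrite mulr1n; case: (boolP (i \in K)) => Ki.
        rewrite (bigD1 i) //= mxE !eqxx big1 ?addr0 // => l /andP[_ li].
        by rewrite mxE eq_sym (negPf li).
      rewrite big1 // => l Kl; rewrite mxE.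
      by case: eqP Kl Ki => //= -> ->.
    rewrite mulr0n big1 // => l _; rewrite mxE.
    by case: eqP => //= <-; case: eqP => // e; rewrite e eqxx in ij.
  rewrite -sum1_card.
  apply: (big_ind2 (fun (A : 'M_n) r => (\rank A <= r)%N)) => [|A r B r' lA lB|i _].
  - by rewrite mxrank0.
  - exact: leq_trans (mxrank_add A B) (leq_add lA lB).
  - by rewrite mxrank_delta.
apply/eqP; rewrite eqn_leq le /=.
have : (n <= \rank (coord_proj J) + \rank (coord_proj (~: J)))%N.
  have e1 : coord_proj J + coord_proj (~: J) = 1%:M.
    by rewrite -[RHS]diag_const_mx -raddfD; congr diag_mx; apply/rowP => j;
      rewrite !mxE inE; case: (j \in J); rewrite ?addr0 ?add0r.
  by rewrite -[X in (X <= _)%N](mxrank1 F) -e1 mxrank_add.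
move=> le_n; rewrite -(leq_add2r #|~: J|) cardsC card_ord (leq_trans le_n) //.
by rewrite leq_add2l.
Qed.

(** Each coordinate in [J] but not in [K] raises the rank by at most one. *)
Lemma rank_proj_le p (A : 'M[F]_(p, n)) J K :
  (\rank (A *m coord_proj J) <= \rank (A *m coord_proj K) + #|J :\: K|)%N.
Proof.
rewrite (coord_proj_split J K) mulmxDr.
apply: leq_trans (mxrank_add _ _) _; apply: leq_add.
  by rewrite setIC -coord_projM mulmxA mxrankM_maxl.
by rewrite -rank_coord_proj mxrankM_maxr.
Qed.

(* Pivots stand in for Shearer's inequality: the projection of [A] to any set
   [X] of coordinates has rank at least [#|X :&: P|]. *)
Lemma ex_pivots p (A : 'M[F]_(p, n)) J :
  exists P, [/\ P \subset J, #|P| = \rank (A *m coord_proj J)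
              & (coord_proj P <= A *m coord_proj P)%MS].
Proof.
set B := A *m coord_proj J; pose f := maxrankfun B^T.
pose Q := [set f x | x in 'I_(\rank B^T)].
have cQ : (#|Q| <= \rank B)%N.
  by rewrite (leq_trans (leq_imset_card _ _)) // card_ord mxrank_tr.
(* [f] selects independent columns of [B] that realise its rank, and the projection to [Q] leaves
   these columns unchanged. *)
have rQ : (\rank B <= \rank (B *m coord_proj Q))%N.
  have <- : \rank (rowsub f B^T) = \rank B by rewrite eq_maxrowsub mxrank_tr.
  have -> : rowsub f B^T = rowsub f 1%:M *m (B *m coord_proj Q)^T.
    rewrite mul_rowsub_mx mul1mx; apply/matrixP => x j.
    by rewrite /coord_proj mul_mx_diag !mxE imset_f ?mulr1.
  by rewrite -(mxrank_tr (B *m _)) mxrankM_maxr.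
have eB : B *m coord_proj Q = A *m coord_proj (J :&: Q).
  by rewrite -mulmxA coord_projM.
have le : (\rank (A *m coord_proj (J :&: Q)) <= #|J :&: Q|)%N.
  by rewrite -rank_coord_proj mxrankM_maxr.
have le2 : (#|J :&: Q| <= #|Q|)%N by rewrite subset_leq_card ?subsetIr.
have cP : #|J :&: Q| = \rank B.
  apply/eqP; rewrite eqn_leq (leq_trans le2 cQ) /=.
  by apply: leq_trans rQ _; rewrite eB.
exists (J :&: Q); split; rewrite ?subsetIl //.
by rewrite -(geq_leqif (mxrank_leqif_sup (submxMl A _))) rank_coord_proj cP -eB.
Qed.

(* Submodularity applied to [A + B] and [A + C] projected to [J]: their sum is
   everything, and their intersection contains [A] and [F^K]. *)
Lemma rank_three_le pa pb pc (A : 'M[F]_(pa, n)) (B : 'M_(pb, n)) (C : 'M_(pc, n))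
    J Jb Jc K P :
    K \subset J -> P \subset J -> (coord_proj P <= A *m coord_proj P)%MS ->
    (coord_proj J <= A + B + C)%MS ->
    (coord_proj K <= A + B)%MS -> (coord_proj K <= A + C)%MS ->
  (#|J| + #|K :|: P| <= 2 * \rank (A *m coord_proj J)
    + (\rank (B *m coord_proj Jb) + #|J :\: Jb|)
    + (\rank (C *m coord_proj Jc) + #|J :\: Jc|))%N.
Proof.
move=> sKJ sPJ pivP sJ sKb sKc.
set M := A *m coord_proj J.
have leB := rank_proj_le B J Jb; have leC := rank_proj_le C J Jc.
set N := B *m coord_proj J in leB; set O := C *m coord_proj J in leC.
have leMN := mxrank_adds_leqif M N; have leMO := mxrank_adds_leqif M O.
have cap := mxrank_sum_cap (M + N)%MS (M + O)%MS.
set G := ((M + N) :&: (M + O))%MS in cap.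
have geJ : (#|J| <= \rank (M + N + (M + O))%MS)%N.
  rewrite -rank_coord_proj mxrankS //.
  apply: submx_trans (coord_proj_sub_proj (subxx J) sJ) _.
  rewrite addsmxMr addsmx_sub addsmxMr addsmxSl /=.
  exact: submx_trans (addsmxSr M O) (addsmxSr _ _).
have geK : (#|K :|: P| <= \rank G)%N.
  rewrite -rank_coord_proj.
  have sKG : (coord_proj K <= G)%MS.
    by rewrite /G sub_capmx; apply/andP; split; rewrite -addsmxMr coord_proj_sub_proj.
  have sMG : (M <= G)%MS by rewrite /G sub_capmx !addsmxSl.
  have sKGD (L : {set 'I_n}) : L \subset K -> (coord_proj L <= G *m coord_proj (K :|: P))%MS.
    move=> sLK; apply: coord_proj_sub_proj.
      exact: subset_trans sLK (subsetUl _ _).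
    apply/sub_coord_projP => i Li; move: sKG => /sub_coord_projP; apply.
    exact: (subsetP sLK).
  suff : (coord_proj (K :|: P) <= G *m coord_proj (K :|: P))%MS.
    by move=> /mxrankS le; apply: leq_trans le (mxrankM_maxl _ _).
  apply/sub_coord_projP => i; rewrite in_setU.
  case: (boolP (i \in P)) => [Pi _|Pi]; last first.
    rewrite orbF => Ki; have /sub_coord_projP := sKGD K (subxx K); exact.
  have /sub_coord_projP/(_ i Pi)/submxP[u ->] := pivP.
  (* The vector [u *m M] lies in [G]. Its projection to [K :|: P] differs from the unit vector at
     [i] only in coordinates of [K] outside [P], and [G] contains [F^K]. *)
  have -> : u *m (A *m coord_proj P) =
      u *m M *m coord_proj (K :|: P) - u *m A *m coord_proj ((K :|: P) :\: P).
    rewrite /M -!mulmxA coord_projM (setIidPr _) ?subUset ?sKJ ?sPJ //.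
    by rewrite (coord_proj_split (K :|: P) P) (setIidPr _) ?subsetUr // !mulmxDr addrK.
  rewrite addmx_sub ?eqmx_opp //.
    by rewrite submxMr // (submx_trans (submxMl u M)).
  apply: submx_trans (submxMl _ _) (sKGD _ _).
  by rewrite setDUl setDv setU0 subsetDl.
by move: leMN.1 leMO.1; lia.
Qed.

End CoordinateProjections.

(** * Sums over ordered pairs of distinct elements *)

Lemma sum_pairs_const (T : finType) (Y : {set T}) (x : nat) :
  (\sum_(b in Y) \sum_(c in Y | c != b) x = #|Y| * #|Y|.-1 * x)%N.
Proof.
rewrite -mulnA -[RHS]sum_nat_const; apply: eq_bigr => b Yb.
rewrite sum_nat_const; congr (_ * _)%N.
by rewrite (cardsD1 b Y) Yb /=; apply: eq_card => c; rewrite !inE andbC.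
Qed.

(** Each element of [Y] is the first entry of [#|Y|.-1] ordered pairs and the second entry of as
    many. *)
Lemma sum_pairsD (T : finType) (Y : {set T}) (h : T -> nat) :
  (\sum_(b in Y) \sum_(c in Y | c != b) (h b + h c)
     = 2 * #|Y|.-1 * \sum_(b in Y) h b)%N.
Proof.
have cY b : b \in Y -> #|[pred c in Y | c != b]| = #|Y|.-1.
  move=> Yb; rewrite (cardsD1 b Y) Yb /=.
  by apply: eq_card => c; rewrite !inE andbC.
under eq_bigr do rewrite big_split /=.
rewrite big_split /= [X in (_ + X)%N](exchange_big_dep (mem Y)) /=; last first.
  by move=> b c _ /andP[].
rewrite -mulnA mul2n -addnn big_distrr /=; congr (_ + _)%N; apply: eq_bigr => b Yb.
  by rewrite sum_nat_const cY.
rewrite sum_nat_const -(cY b Yb); congr (_ * _)%N.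
by apply: eq_card => c; rewrite !inE Yb /= eq_sym.
Qed.

Lemma card_in_sum (T : finType) (A B : {set T}) :
  A \subset B -> #|A| = (\sum_(i in B) (i \in A))%N.
Proof.
move=> /setIidPr AB; rewrite -sum1_card -[in LHS]AB big_mkcond [RHS]big_mkcond /=.
by apply: eq_bigr => i _; rewrite inE; case: (i \in B); case: (i \in A).
Qed.

(** * Missing buckets and the rank of a bucket *)

Section Code.
Variables (F : finFieldType) (n k : nat) (Nl : 'I_(k + 2) -> nat).
Variable C : forall l : 'I_(k + 2), 'M[F]_(n, Nl l).

Local Notation evec i := (delta_mx (0 : 'I_1) i).
Local Notation V l := (C l)^T.

Definition missing (i : 'I_n) := [set l | ~~ (evec i <= V l)%MS].

(** Testing the recovery identity on all unit vectors turns it into an identity between row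
    vectors. *)
Lemma delta_mx_sum_buckets (i : 'I_n) (R : 'I_(k + 2) -> 'I_k)
    (f : forall l, 'cV[F]_(Nl l)) (a : 'I_(k + 2) -> F) (j : 'I_k) :
    (forall x : 'rV_n,
       x 0 i = \sum_(l | R l == j) a l * ((x *m C l) *m f l) 0 0) ->
  evec i = \sum_(l | R l == j) (a l *: (f l)^T) *m V l.
Proof.
move=> rec; apply/rowP => t; rewrite summxE.
have -> : evec i 0 t = evec t 0 i :> F by rewrite !mxE eq_sym.
rewrite rec; apply: eq_bigr => l _.
by rewrite -mulmxA -rowE -scalemxAl -trmx_mul !mxE.
Qed.

(* Each of the [k] parts is nonempty and the singleton parts consist of buckets
   giving [x_i] directly, so a part of size [s] contains at most [2 (s - 1)]
   missing buckets; these bounds sum to [4]. *)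
Lemma missing_pairs : PIR_array_code k C -> forall i,
  (#|missing i| <= 4)%N /\
  exists R : 'I_(k + 2) -> 'I_k, #|missing i| = 4%N ->
    (forall a, a \in missing i -> #|[set b in missing i | R b == R a]| = 2%N) /\
    (forall a b, a \in missing i -> b \in missing i -> a != b -> R a = R b ->
       (evec i <= V a + V b)%MS).
Proof.
move=> [_ code] i; have [R [f [a rec]]] := code i.
have {}rec j := delta_mx_sum_buckets (rec j).
pose fib (A : {set 'I_(k + 2)}) j := [set l in A | R l == j].
have sum_fib A : (\sum_j #|fib A j| = #|A|)%N.
  rewrite -[RHS]sum1_card (partition_big R xpredT) //=; apply: eq_bigr => j _.
  by rewrite -sum1_card; apply: eq_bigl => l; rewrite inE.
have fibT_gt0 j : (0 < #|fib setT j|)%N.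
  rewrite lt0n; apply/negP => /eqP/cards0_eq f0.
  have : evec i = 0 :> 'rV[F]_n.
    by rewrite (rec j) big1 // => l Rl; have := in_set0 l; rewrite -f0 !inE Rl.
  by move/rowP/(_ i)/eqP; rewrite !mxE !eqxx oner_eq0.
have sub_fib j : fib (missing i) j \subset fib setT j.
  by apply/subsetP => l; rewrite !inE => /andP[_ ->].
have le_fib j : (#|fib (missing i) j| + 2 <= 2 * #|fib setT j|)%N.
  have := subset_leq_card (sub_fib j); have := fibT_gt0 j.
  have [f1|] := eqVneq #|fib setT j| 1%N; last by lia.
  suff -> : fib (missing i) j = set0 by rewrite cards0 f1.
  have /cards1P[l fl] : #|fib setT j| == 1%N by rewrite f1.
  apply/setP => l'; rewrite !inE; apply/negP => /andP[/negP Ml' Rl'].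
  have el p : (R p == j) = (p == l).
    by have /setP/(_ p) := fl; rewrite !inE.
  apply: Ml'; rewrite (rec j) (bigD1 l') //= big1 ?addr0 ?submxMl // => p.
  by rewrite !el in Rl' *; rewrite (eqP Rl') => /andP[->].
have le_sum : (#|missing i| + 2 * k <= 4 + 2 * k
    ?= iff [forall j, #|fib (missing i) j| + 2 == 2 * #|fib setT j|])%N.
  have -> : (4 + 2 * k = 2 * #|[set: 'I_(k + 2)]|)%N.
    by rewrite cardsT card_ord; lia.
  rewrite -!sum_fib big_distrr /=.
  have -> : (2 * k = \sum_(j < k) 2)%N by rewrite sum_nat_const card_ord mulnC.
  rewrite -big_split /=.
  exact: leqif_sum (fun j _ => leqif_eq (le_fib j)).
split; first by have := le_sum.1; lia.
exists R => M4.
(* Four missing buckets make the summed bound tight, hence the bound of every single part. *)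
have {}eq_fib j : (#|fib (missing i) j| + 2 = 2 * #|fib setT j|)%N.
  have := le_sum.2; rewrite M4 eqxx => /esym/forallP/(_ j)/eqP; exact.
have card_fib c : c \in missing i ->
    #|fib (missing i) (R c)| = 2%N /\ fib setT (R c) = fib (missing i) (R c).
  move=> Mc; have := eq_fib (R c); have := subset_leq_card (sub_fib (R c)).
  have : (0 < #|fib (missing i) (R c)|)%N.
    by rewrite card_gt0; apply/set0Pn; exists c; rewrite inE Mc eqxx.
  (* With [m] missing buckets in a part of size [s], [m + 2 = 2 * s] and [0 < m <= s] force
     [m = s = 2]. *)
  move=> gt0 le e; have {}e : #|fib (missing i) (R c)| = 2%N by lia.
  split=> //; apply/esym/eqP; rewrite eqEcard sub_fib /=.
  by rewrite -(@leq_pmul2l 2) // -eq_fib e.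
split=> [c Mc|c d Mc Md cd Rcd]; first exact: (card_fib c Mc).1.
have [c2 fE] := card_fib c Mc.
have fcd : fib setT (R c) = [set c; d].
  apply/esym/eqP; rewrite eqEcard fE c2 cards2 cd andbT.
  by apply/subsetP => l /set2P[]->; rewrite inE ?Mc ?Md ?Rcd eqxx.
rewrite (rec (R c)); apply: summx_sub => l Rl.
have : l \in fib setT (R c) by rewrite !inE.
rewrite fcd !inE => /orP[]/eqP->.
  exact: submx_trans (submxMl _ _) (addsmxSl _ _).
exact: submx_trans (submxMl _ _) (addsmxSr _ _).
Qed.

(** The unit vectors that lie in [V a] have their coordinate outside [J], so the projection to [J]
    kills them; rank-nullity adds the two counts. *)
Lemma rank_bucket_ge a (J : {set 'I_n}) :
    (forall i, i \in J -> a \in missing i) ->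
  (#|[set i | a \notin missing i]| + \rank (V a *m coord_proj F J) <= \rank (V a))%N.
Proof.
move=> Ja; set I := [set i | _].
rewrite -(mxrank_mul_ker (V a) (coord_proj F J)) addnC leq_add2l.
rewrite -(rank_coord_proj F) mxrankS // sub_capmx; apply/andP; split.
  by apply/sub_coord_projP => i; rewrite !inE negbK.
apply/sub_kermxP; rewrite coord_projM; have -> : I :&: J = set0.
  by apply/setP => i; rewrite !inE; apply/negP => /andP[/negP nMa /Ja]; rewrite inE.
by apply/matrixP => i j; rewrite !mxE inE mul0rn.
Qed.

(* The parts of a light [i] are [k - 2] singletons and two pairs of missing
   buckets; any other [i] is contained in at least [k - 1] buckets. *)
Definition light := [set i | #|missing i| == 4%N].
Definition light_missing a := [set i in light | a \in missing i].
Definition extra_rank a := \rank (V a *m coord_proj F (light_missing a)).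
Local Notation J := light_missing.
Local Notation w := extra_rank.

(** * Averaging the rank inequality over triples of buckets *)

Section Counting.
Hypothesis k_gt1 : (1 < k)%N.
Variable R : 'I_n -> 'I_(k + 2) -> 'I_k.
Hypothesis card_block : forall i a, i \in light -> a \in missing i ->
  #|[set b in missing i | R i b == R i a]| = 2%N.
Hypothesis block_sub : forall i a b, i \in light -> a \in missing i ->
  b \in missing i -> a != b -> R i a = R i b -> (evec i <= V a + V b)%MS.

(** For light [i] and missing [a], this is the pair that does not contain [a]. *)
Definition cross a i := [set b in missing i | R i b != R i a].

Lemma card_cross a i : i \in J a -> #|cross a i| = 2%N.
Proof.
rewrite inE => /andP[Li Ma]; have := card_block Li Ma.
have : #|missing i| = 4%N by move: Li; rewrite inE => /eqP.
rewrite -(cardsID [set b | R i b == R i a]).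
have -> : missing i :&: [set b | R i b == R i a] = [set b in missing i | R i b == R i a].
  by apply/setP => b; rewrite !inE.
have -> : missing i :\: [set b | R i b == R i a] = cross a i.
  by apply/setP => b; rewrite !inE andbC.
by move=> + e; rewrite e => -[].
Qed.

Lemma not_cross_sub a b i :
  i \in J a -> b != a -> b \notin cross a i -> (evec i <= V a + V b)%MS.
Proof.
rewrite inE => /andP[Li Ma] ba; rewrite inE.
have [Mb /negPn/eqP Rb|nMb _] := boolP (b \in missing i).
  by apply: block_sub; rewrite // eq_sym.
have : (evec i <= V b)%MS by move: nMb; rewrite inE negbK.
by move=> s; apply: submx_trans s (addsmxSr _ _).
Qed.

Lemma triple_sub a b c i : i \in J a -> b != a -> c != a -> c != b ->
  (evec i <= V a + V b + V c)%MS.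
Proof.
move=> Ji ba ca cb; have [Li Ma] : i \in light /\ a \in missing i.
  by apply/andP; move: Ji; rewrite inE.
have [Db|] := boolP (b \in cross a i); last first.
  move/(not_cross_sub Ji ba) => s; exact: submx_trans s (addsmxSl _ _).
have [Dc|] := boolP (c \in cross a i); last first.
  move/(not_cross_sub Ji ca) => s; apply: submx_trans s _.
  by rewrite addsmxS ?addsmxSl.
have Dbc : cross a i = [set b; c].
  apply/esym/eqP; rewrite eqEcard card_cross // cards2 eq_sym cb andbT.
  by apply/subsetP => l /set2P[]->.
have [Mb Rb] : b \in missing i /\ R i b != R i a by apply/andP; move: Db; rewrite inE.
have [Mc Rc] : c \in missing i /\ R i c != R i a by apply/andP; move: Dc; rewrite inE.
have sB : [set l in missing i | R i l == R i b] = cross a i.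
  apply/eqP; rewrite eqEcard card_cross // card_block // andbT.
  by apply/subsetP => l; rewrite !inE => /andP[-> /eqP->].
have : c \in [set l in missing i | R i l == R i b] by rewrite sB.
rewrite inE Mc /= => /eqP Rcb.
have s : (evec i <= V b + V c)%MS by apply: block_sub; rewrite // eq_sym.
by apply: submx_trans s _; rewrite addsmxS ?addsmxSr.
Qed.

(* [rank_three_le] summed over the ordered pairs [(b, c)] of buckets other than
   [a]: a pivot of [a] is counted for all [(k + 1) k] pairs, and any other
   [i \in J a] for the [(k - 1) (k - 2)] pairs avoiding [cross a i]. *)
Lemma bucket_ineq a :
  ((2 * k + 2) * #|J a| + (4 * k - 2) * w a <=
     2 * k ^ 2 * w a + 2 * k * \sum_b w b)%N.
Proof.
have [P [sPJ cP pivP]] := ex_pivots (V a) (J a).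
pose Y := [set~ a]; have cY : #|Y| = k.+1.
  by have := cardsC1 a; rewrite card_ord => ->; lia.
pose K b c := [set i in J a | (b \notin cross a i) && (c \notin cross a i)].
pose h b := (w b + #|J a :\: J b|)%N.
have ineq b c : b != a -> c != a -> c != b ->
    (#|J a| + #|K b c :|: P| <= 2 * w a + (h b + h c))%N.
  move=> ba ca cb; rewrite addnA; apply: rank_three_le => //.
  - by apply/subsetP => i; rewrite inE => /andP[].
  - by apply/sub_coord_projP => i Ji; apply: triple_sub.
  - by apply/sub_coord_projP => i; rewrite inE => /and3P[? ? ?]; apply: not_cross_sub.
  - by apply/sub_coord_projP => i; rewrite inE => /and3P[? ? ?]; apply: not_cross_sub.
have sum_ineq : (\sum_(b in Y) \sum_(c in Y | c != b) (#|J a| + #|K b c :|: P|) <=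
    \sum_(b in Y) \sum_(c in Y | c != b) (2 * w a + (h b + h c)))%N.
  apply: leq_sum => b; rewrite !inE => ba; apply: leq_sum => c.
  by rewrite !inE => /andP[ca cb]; apply: ineq.
move: sum_ineq.
under eq_bigr do rewrite big_split /=.
rewrite big_split /= sum_pairs_const cY /=.
under [X in (_ <= X)%N]eq_bigr do rewrite big_split /=.
rewrite [X in (_ <= X)%N]big_split /= sum_pairs_const sum_pairsD cY /=.
(* Each [i] in [J a] lies outside [J b] for exactly the [k - 2] buckets [b] not missing at [i].
   Adding [w a] restores the bucket that [Y] omits. *)
have sum_h : (\sum_(b in Y) h b + w a = \sum_b w b + (k - 2) * #|J a|)%N.
  rewrite big_split /= [in RHS](bigD1 a) //=.
  have -> : (\sum_(b in Y) w b = \sum_(b | b != a) w b)%N.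
    by apply: eq_bigl => b; rewrite !inE.
  suff : (\sum_(b in Y) #|J a :\: J b| = (k - 2) * #|J a|)%N by move=> ->; rewrite addnC addnA.
  under eq_bigr => b _ do rewrite (card_in_sum (subsetDl (J a) (J b))).
  rewrite exchange_big /= mulnC -sum_nat_const; apply: eq_bigr => i Ji.
  have [Li Ma] : i \in light /\ a \in missing i by apply/andP; move: Ji; rewrite inE.
  have cL : #|missing i| = 4%N by move: Li; rewrite inE => /eqP.
  have cLC : #|~: missing i| = (k - 2)%N.
    by have := cardsC (missing i); rewrite cL card_ord; lia.
  rewrite -cLC (@card_in_sum _ _ Y); last first.
    by apply/subsetP => b; rewrite !inE; apply: contraNneq => ->; move: Ma; rewrite inE.
  by apply: eq_bigr => b _; rewrite in_setD in_setC Ji andbT inE Li.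
have sum_K : ((k - 1) * (k - 2) * #|J a| + (4 * k - 2) * w a <=
    \sum_(b in Y) \sum_(c in Y | c != b) #|K b c :|: P|)%N.
  have sub b c : K b c :|: P \subset J a.
    by rewrite subUset sPJ andbT; apply/subsetP => i; rewrite inE => /andP[].
  under [X in (_ <= X)%N]eq_bigr => b _.
    under eq_bigr => c _ do rewrite (card_in_sum (sub b c)).
    rewrite exchange_big /=.
    over.
  rewrite exchange_big /= /w -cP (card_in_sum sPJ).
  rewrite mulnC -sum_nat_const big_distrr -big_split /=; apply: leq_sum => i Ji.
  have [Pi|nPi] := boolP (i \in P).
    under eq_bigr => b _ do under eq_bigr => c _ do rewrite inE Pi orbT.
    by rewrite sum_pairs_const cY /=; nia.
  pose Z := Y :\: cross a i.
  have cZ : #|Z| = (k - 1)%N.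
    rewrite cardsD (setIidPr _) ?card_cross // ?cY; first by lia.
    by apply/subsetP => b; rewrite !inE; apply: contraTneq => ->; rewrite eqxx andbF.
  rewrite muln0 addn0.
  have -> : ((k - 1) * (k - 2) = \sum_(b in Z) \sum_(c in Z | c != b) 1)%N.
    by rewrite sum_pairs_const cZ; nia.
  rewrite big_mkcond [X in (_ <= X)%N]big_mkcond /=; apply: leq_sum => b _.
  rewrite in_setD andbC; case: (b \in Y) => //=; case Db: (b \in cross a i) => //=.
  rewrite big_mkcond [X in (_ <= X)%N]big_mkcond /=; apply: leq_sum => c _.
  rewrite in_setD andbC; case: (c \in Y) => //=; case: (c != b) => //=; rewrite ?andbF //.
  by case Dc: (c \in cross a i) => //=; rewrite in_setU inE Ji Db Dc.
move: k_gt1 sum_h sum_K; move: (\sum_(b in Y) h b)%N (w a) (\sum_b w b)%N #|J a|.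
move: (\sum_(b in Y) _)%N.
case: k => [|[|k']] // S H wa E M _; rewrite !subSS !subn0 /=; nia.
Qed.

End Counting.

(** * Summation over all buckets and the bound on the length *)

Lemma total_extra_rank : (1 < k)%N -> PIR_array_code k C ->
  ((8 * k + 8) * #|light| <= (4 * k ^ 2 + 2) * \sum_a w a)%N.
Proof.
move=> k_gt1 code.
(* In [missing_pairs] the map [R] exists before the assumption of four missing buckets, so one can
   be chosen for every [i], light or not. *)
have [R Rh] := fin_all_exists (fun i => (missing_pairs code i).2).
have light4 i : i \in light -> #|missing i| = 4%N by rewrite inE => /eqP.
have ineq a := bucket_ineq k_gt1 (fun i b Li => (Rh i (light4 i Li)).1 b)
  (fun i b c Li => (Rh i (light4 i Li)).2 b c) a.
have sumJ : (\sum_a #|J a| = 4 * #|light|)%N.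
  have sJ a : J a \subset light by apply/subsetP => i; rewrite inE => /andP[].
  under eq_bigr => a _ do rewrite (card_in_sum (sJ a)).
  rewrite exchange_big /= mulnC -sum_nat_const; apply: eq_bigr => i Li.
  rewrite -(light4 i Li) (card_in_sum (subsetT _)) [RHS]big_mkcond /=.
  by apply: eq_bigr => a _; rewrite in_setT [in LHS]inE Li.
have : (\sum_a ((2 * k + 2) * #|J a| + (4 * k - 2) * w a) <=
    \sum_a (2 * k ^ 2 * w a + 2 * k * \sum_b w b))%N.
  exact: leq_sum (fun a _ => ineq a).
rewrite !big_split /= -!big_distrr /= sumJ sum_nat_const card_ord.
move: (\sum_a w a)%N #|light| => E g.
have -> : (2 * k ^ 2 * E + 2 * k * ((k + 2) * E)
    = (4 * k ^ 2 + 2) * E + (4 * k - 2) * E)%N.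
  by rewrite mulnA -!mulnDl; congr (_ * _)%N; rewrite -mulnn; nia.
have -> : ((2 * k + 2) * (4 * g) = (8 * k + 8) * g)%N by lia.
by rewrite leq_add2r.
Qed.

(** Each [i] lies in at least [k - 1] bucket spans, or in [k - 2] if it is light; the extra ranks
    come on top by [rank_bucket_ge]. *)
Lemma code_length_ge : PIR_array_code k C ->
  ((k + 2) * n + \sum_a w a <= array_code_length Nl + 3 * n + #|light|)%N.
Proof.
move=> code.
have bucket a : (#|[set i | a \notin missing i]| + w a <= Nl a)%N.
  apply: leq_trans (rank_bucket_ge _) (rank_leq_row _) => i.
  by rewrite inE => /andP[].
set S := (\sum_a #|[set i | a \notin missing i]|)%N.
have lenS : (S + \sum_a w a <= array_code_length Nl)%N.
  by rewrite -big_split /=; apply: leq_sum => a _; apply: bucket.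
suff : ((k + 2) * n <= S + 3 * n + #|light|)%N.
  by move: lenS; move: S (\sum_a w a)%N #|light| => S W g; lia.
rewrite /S.
have -> : (\sum_a #|[set i | a \notin missing i]| = \sum_i #|~: missing i|)%N.
  under eq_bigr => a _ do rewrite (card_in_sum (subsetT _)).
  rewrite exchange_big /= big_mkcond; apply: eq_bigr => i _.
  rewrite in_setT (card_in_sum (subsetT _)) [LHS]big_mkcond [RHS]big_mkcond /=.
  by apply: eq_bigr => a _; rewrite !in_setT in_setC inE.
rewrite (card_in_sum (subsetT light)).
have -> : (3 * n = \sum_(i < n) 3)%N by rewrite sum_nat_const card_ord mulnC.
have -> : ((k + 2) * n = \sum_(i < n) (k + 2))%N by rewrite sum_nat_const card_ord mulnC.
rewrite [X in (_ <= _ + X)%N]big_mkcond -!big_split /=; apply: leq_sum => i _.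
have [le4 _] := missing_pairs code i; move: le4 (cardsC (missing i)).
rewrite in_setT inE card_ord; move: #|missing i| #|~: missing i| => x y /=.
by case: (x =P 4); lia.
Qed.

End Code.

(* N_P(n,k,k+2) >= (k-2 + (4k+16)/(3k^2+k+4)) n, i.e. every
   (n,N,k,k+2)-PIR array code over F has N at least this bound. *)
Theorem theorem3p4 (F : finFieldType) (n k : nat)
    (Nl : 'I_(k + 2) -> nat) (C : forall l : 'I_(k + 2), 'M[F]_(n, Nl l)) :
  (0 < n)%N -> (3 <= k)%N ->
  @PIR_array_code F n k (k + 2) Nl C ->
  ((k - 2)%:R + (4 * k + 16)%:R / (3 * k ^ 2 + k + 4)%:R) * n%:R
    <= (array_code_length Nl)%:R :> rat.
Proof.
move=> _ k_ge3 code.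
have extra := total_extra_rank (ltnW k_ge3) code.
have len := code_length_ge code.
have light_n : (#|light C| <= n)%N by rewrite -[leqRHS]card_ord max_card.
have den_gt0 : 0 < (3 * k ^ 2 + k + 4)%:R :> rat by rewrite ltr0n; lia.
rewrite -(ler_pM2r den_gt0) mulrAC mulrDl (divfK (lt0r_neq0 den_gt0)).
suff : (((k - 2) * (3 * k ^ 2 + k + 4) + (4 * k + 16)) * n
    <= array_code_length Nl * (3 * k ^ 2 + k + 4))%N.
  by rewrite -(ler_nat rat) natrM (natrM _ (array_code_length _)) (natrD _ (_ * _)%N) natrM.
move: extra len light_n; move: (\sum_a _)%N #|light C| (array_code_length Nl).
move=> E g N extra len light_n; set d := (3 * k ^ 2 + k + 4)%N.
(* [T] is the length beyond [(k - 2) * n]: one for each [i] that is not light, plus the total extra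
   rank. *)
have [T eN leT] : exists2 T, N = ((k - 2) * n + T)%N & (n - g + E <= T)%N.
  have eS : ((k + 2) * n = (k - 2) * n + 4 * n)%N by rewrite -mulnDl; congr (_ * _)%N; lia.
  by exists (N - (k - 2) * n)%N; lia.
(* The two sides differ by [8 * k * (k - 2) ^ 2]. *)
have dens : ((4 * k + 16) * (4 * k ^ 2 + 2) <= (8 * k + 8) * d)%N.
  rewrite /d; have [j ->] : exists j, k = j.+2 by exists (k - 2)%N; lia.
  have -> : ((8 * j.+2 + 8) * (3 * j.+2 ^ 2 + j.+2 + 4)
      = (4 * j.+2 + 16) * (4 * j.+2 ^ 2 + 2) + 8 * j.+2 * (j * j))%N.
    by rewrite -!mulnn; lia.
  exact: leq_addr.
(* An [i] that is not light contributes one to [T], which must be no less than the share guaranteed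
   per light [i]; this uses [3 <= k]. *)
have slope : (8 * k + 8 <= 4 * k ^ 2 + 2)%N.
  by have := leq_mul k_ge3 (leqnn k); rewrite -mulnn; lia.
have leTn : ((8 * k + 8) * n <= (4 * k ^ 2 + 2) * T)%N.
  apply: leq_trans (leq_mul (leqnn _) leT).
  rewrite -[in leqLHS](subnK light_n) !mulnDr leq_add //.
  by rewrite leq_mul2r slope orbT.
rewrite eN mulnDl [leqRHS]mulnDl mulnAC leq_add2l.
have : (0 < 4 * k ^ 2 + 2)%N by rewrite addn2.
move: dens leTn; move: (4 * k ^ 2 + 2)%N (4 * k + 16)%N (8 * k + 8)%N d => c x y d.
move=> dens leTn c_gt0; rewrite -(leq_pmul2l c_gt0).
apply: (@leq_trans (y * n * d)%N).
  by have := leq_mul dens (leqnn n); lia.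
by have := leq_mul leTn (leqnn d); lia.
Qed.
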